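(* Let $P$ be a finite poset with underlying set $V$, $|V|=n$. Then the map $r$ is a bijection from the set of weakly decreasing Hamiltonian paths on $P$ to the set of acyclic orientations of $\mathrm{inc}(P)$, and its inverse is the map $s$.
   Context: $\mathrm{inc}(P)$ is the graph on $V$ with an edge between $v$ and $w$ iff $v,w$ are incomparable in $P$. A weakly decreasing Hamiltonian path on $P$ is a sequence $(v_1,\ldots,v_n)$ listing each element of $V$ exactly once such that for each $i$, $v_i$ is not less than $v_{i+1}$ in $P$. For such a path $F$, $r(F)$ is the orientation of $\mathrm{inc}(P)$ obtained as follows: for $i=1,2,\ldots,n$ in turn, direct every not yet directed edge of $\mathrm{inc}(P)$ incident to $v_i$ toward $v_i$ (equivalently, an edge between $v_i$ and $v_j$ with $i<j$ is directed from $v_j$ to $v_i$). For an acyclic orientation $A$ of $\mathrm{inc}(P)$, $s(A)$ is the sequence $(v_1,\ldots,v_n)$ where $v_i$ is the greatest element in $P$ of the set of sinks of the restriction of $A$ to $V\setminus\{v_1,\ldots,v_{i-1}\}$ (this set of sinks is nonempty and, being pairwise non-adjacent in $\mathrm{inc}(P)$, is totally ordered by $P$). *)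

(* Defs.v *)
From mathcomp Require Import all_boot all_order.

Set Implicit Arguments.
Unset Strict Implicit.
Unset Printing Implicit Defensive.

Local Open Scope order_scope.

Section Digraphs.
Variable T : finType.
Implicit Types (e : rel T) (A : {set T * T}) (U : {set T}).

(* A set of arcs: (v, w) \in A means that A has an arc directed from v to w.  *)
Definition arc A : rel T := fun v w => (v, w) \in A.

(* e is the (symmetric, irreflexive) adjacency relation of a simple graph.    *)
Definition orientation e A : Prop :=
  (forall v w, arc A v w -> e v w) /\
  (forall v w, e v w -> arc A v w (+) arc A w v).

Definition acyclic A : Prop := forall c : seq T, ucycle (arc A) c -> c = [::].

Definition acyclic_orientation e A : Prop := orientation e A /\ acyclic A.

Definition restrict A U : {set T * T} := A :&: setX U U.

Definition sinks A U : {set T} :=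
  [set v in U | [forall w, ~~ arc (restrict A U) v w]].

End Digraphs.

Section Paths.
Variables (d : Order.disp_t) (P : finPOrderType d).
Implicit Types (F : seq P) (A D : {set P * P}).

Definition inc : rel P := fun v w => v >< w.

Definition weakly_decreasing_hampath F : Prop :=
  (forall v, count_mem v F = 1%N) /\ sorted (fun v w => ~~ (v < w)) F.

(* D is the set of edges directed so far.                                     *)
Definition direct_toward D (v : P) : {set P * P} :=
  D :|: [set a | [&& a.2 == v, inc a.1 v, ~~ arc D a.1 v & ~~ arc D v a.1]].

Definition r F : {set P * P} := foldl direct_toward set0 F.

Definition greatest (S : {set P}) : option P :=
  [pick v in S | [forall w in S, w <= v]].

(* The None case, a set of sinks without greatest element, does not occur for *)
(* acyclic orientations of inc; it would leave s A with fewer than #|P| terms.*)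
Definition s_step A F : seq P :=
  if greatest (sinks A [set v | v \notin F]) is Some v then rcons F v else F.

Definition s A : seq P := iter #|P| (s_step A) [::].

End Paths.

(* Main.v *)
From mathcomp Require Import all_boot all_order.
Require Import Defs.

(** For a complete duplicate-free sequence [F], the arcs of [r F] are the
    incomparable pairs [(v, w)] such that [w] precedes [v] in [F].  If [F] is
    weakly decreasing, any later [w] that is a sink of what remains after the
    first [i] terms is comparable with all the terms between position [i] and its
    own; going back from [w], weak decrease forces each of them to be greater
    than [w].  Hence the term at position [i] is the greatest sink, and [s]
    recovers [F].  Conversely, [s A] removes sinks one at a time, so the arcs of
    [A] go backwards along [s A], which gives [r (s A) = A].  The sequence [s A]
    is weakly decreasing because an [x] removed right after [y] with [y < x] is
    not adjacent to [y], hence would already have been a sink when [y] was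
    chosen as the greatest one. *)

Set Implicit Arguments.
Unset Strict Implicit.
Unset Printing Implicit Defensive.

Import Order.POrderTheory.

(** * Sinks and acyclicity in finite digraphs *)

Section Digraphs.
Variable T : finType.
Implicit Types (A : {set T * T}) (U : {set T}) (f : T -> nat) (v w : T).

Lemma sinksP A U v :
  reflect (v \in U /\ forall w, w \in U -> ~~ arc A v w) (v \in sinks A U).
Proof.
rewrite inE; apply: (iffP andP) => -[vU vsink]; split=> //.
  move=> w wU; move/forallP/(_ w): vsink.
  by rewrite /arc !inE /= vU wU !andbT.
apply/forallP => w; rewrite /arc !inE /= vU /=; apply/negP => /andP[vw wU].
by move: (vsink w wU); rewrite /arc vw.
Qed.

Lemma acyclic_ranked A f :
  (forall v w, arc A v w -> f w < f v) -> acyclic A.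
Proof.
move=> fA [//|x c] /andP[/= xc _].
have : path (fun v w => f w < f v) x (rcons c x) by exact: sub_path xc.
move=> /order_path_min-/(_ (fun _ _ _ h1 h2 => ltn_trans h2 h1)).
by rewrite all_rcons ltnn.
Qed.

(* A vertex of [U] reaching as few vertices as possible is a sink: otherwise an
   out-neighbour in [U] would reach it back and close a cycle. *)
Lemma acyclic_sinks_neq0 A U : acyclic A -> U != set0 -> sinks A U != set0.
Proof.
move=> acA /set0Pn[x xU]; apply/set0Pn.
case: (@arg_minnP _ x (mem U) (fun v => #|connect (arc A) v|) xU) => v vU vmin.
exists v; apply/sinksP; split=> // w wU; apply/negP => vw.
have sub_wv : connect (arc A) w \subset connect (arc A) v.
  by apply/subsetP => u wu; apply: connect_trans (connect1 vw) wu.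
have /subset_cardP/(_ sub_wv)/(_ v) : #|connect (arc A) w| = #|connect (arc A) v|.
  by apply/eqP; rewrite eqn_leq subset_leq_card //=; apply: vmin.
(* [acyclic] only forbids cycles with distinct vertices, so the path from [w] back to [v] is first
   shortened to a simple one. *)
rewrite [RHS]connect0 => /connectP[p0 p0A vE].
case/shortenP: p0A vE => p pA p_uniq _ vE.
suff /acA : ucycle (arc A) (w :: p) by [].
by rewrite /ucycle /ucycleb /= rcons_path pA -vE vw.
Qed.

End Digraphs.

Section Paths.
Variables (d : Order.disp_t) (P : finPOrderType d).
Implicit Types (F : seq P) (A : {set P * P}) (S : {set P}) (v w x y : P).

Local Notation inc := (@inc d P).

Lemma inc_sym v w : inc v w = inc w v.
Proof. by rewrite /Defs.inc comparable_sym. Qed.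

Lemma incxx v : inc v v = false.
Proof. by rewrite /Defs.inc comparablexx. Qed.

Lemma greatestP S v :
  greatest S = Some v <-> v \in S /\ forall w, w \in S -> (w <= v)%O.
Proof.
rewrite /greatest; split.
  case: pickP => // u /andP[uS /forall_inP uge] [<-]; by split.
move=> [vS vge]; case: pickP => [u /andP[uS /forall_inP uge]|/(_ v)].
  by congr Some; apply: le_anti; rewrite vge // uge.
by rewrite vS /= => /forall_inP[]; apply: vge.
Qed.

Lemma greatest_chain S :
    {in S &, forall v w, (v >=< w)%O} -> S != set0 ->
  exists v, greatest S = Some v.
Proof.
move=> chainS /set0Pn[x xS].
(* The candidate [v] has the fewest elements of [S] strictly above it; a [w] above [v] would have
   strictly fewer. *)
case: (@arg_minnP _ x (mem S) (fun v => #|[set w in S | (v < w)%O]|) xS).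
move=> v vS vmin; exists v; apply/greatestP; split=> // w wS.
case: (comparable_leP (chainS _ _ wS vS)) => // vw.
have := vmin w wS; rewrite leqNgt => /negP[]; apply: proper_card.
apply/properP; split.
  by apply/subsetP => u; rewrite !inE => /andP[-> /(lt_trans vw)->].
by exists w; rewrite !inE ?wS ?vw // ltxx andbF.
Qed.

(** * From Hamiltonian paths to orientations and back *)

Lemma hampath_uniq F :
  (forall v, count_mem v F = 1) <-> uniq F /\ forall v, v \in F.
Proof.
split=> [F1|[uF inF] v]; last by rewrite count_uniq_mem // inF.
have inF v : v \in F by rewrite -has_pred1 has_count F1.
by split=> //; apply: count_mem_uniq => v; rewrite inF F1.
Qed.

(* If [v] is not in [F] then [index v F] is [size F], so this also covers edges
   with one endpoint outside [F]. *)
Lemma arc_r F v w :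
  uniq F -> arc (r F) v w = inc v w && (index w F < index v F).
Proof.
elim/last_ind: F v w => [|F x IH] v w.
  by rewrite /arc /r inE ltnn andbF.
rewrite rcons_uniq => /andP[xF uF].
rewrite /r -cats1 foldl_cat /= -/(r F) {1}/arc !inE /= -/(arc (r F) v w).
rewrite !IH // !index_cat (memNindex xF) /= (inc_sym x).
(* Only arcs into [x] are new: for [v] incomparable to [x], the arc from [v] is added exactly when
   [v] is not in [F], and then [v] has index [size F + 1] against [size F] for [x]. *)
have [->|wx] := eqVneq w x.
  rewrite (negbTE xF) addn0 memNindex // !(ltnNge (size F)) index_size index_mem.
  have [->|vx] := eqVneq v x; first by rewrite incxx.
  case: (boolP (v \in F)) => vF; case: (inc v x) => //=.
    by rewrite index_size.
  by rewrite addn1 ltnn.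
rewrite /= orbF; congr (_ && _).
case: (boolP (w \in F)) => wF; case: (boolP (v \in F)) => vF //.
- by rewrite (memNindex vF) ltn_addr index_mem wF.
- by rewrite (memNindex wF) !ltnNge index_size addn1 leqW ?index_size.
by rewrite !memNindex // ltnn ltnNge leq_add2l; case: eqP.
Qed.

Lemma acyclic_orientation_r F :
  uniq F -> (forall v, v \in F) -> acyclic_orientation inc (r F).
Proof.
move=> uF inF; split; last first.
  by apply: (@acyclic_ranked _ _ (index^~ F)) => v w; rewrite arc_r // => /andP[].
split=> v w; first by rewrite arc_r // => /andP[].
move=> vw; rewrite !arc_r // (inc_sym w) vw /=.
case: ltngtP => // /(index_inj v (inF _) (inF _)) wEv.
by move: vw; rewrite wEv incxx.
Qed.

Lemma greatest_sinks_r F x0 i :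
    uniq F -> (forall v, v \in F) -> sorted (fun v w => ~~ (v < w)%O) F ->
    i < size F ->
  greatest (sinks (r F) [set v | v \notin take i F]) = Some (nth x0 F i).
Proof.
move=> uF inF sF iF.
have notin_take v : (v \notin take i F) = (i <= index v F).
  by rewrite in_take // -leqNgt.
apply/greatestP; split.
  apply/sinksP; rewrite inE notin_take index_uniq // leqnn; split=> // w.
  by rewrite inE notin_take arc_r // index_uniq // ltnNge andbC => ->.
move=> w /sinksP[]; rewrite inE notin_take => iw wsink.
set j := index w F in iw.
have jF : j < size F by rewrite index_mem.
have nj : nth x0 F j = w by rewrite nth_index.
(* Descending induction on the position [m], run on its distance [k.+1] to [j]. *)
suff gt_w k : forall m, i <= m -> m + k.+1 = j -> (w < nth x0 F m)%O.
  move: iw; rewrite leq_eqVlt => /predU1P[->|iw]; first by rewrite nj.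
  apply: ltW; apply: (gt_w (j - i).-1) => //.
  by rewrite prednK ?subn_gt0 // subnKC // ltnW.
(* As a sink, [w] has no arc to the term at [m], so they are comparable; if that term were below
   [w], it would be below its successor in [F]. *)
have gt_pred m : i <= m -> m < j -> (w <= nth x0 F m.+1)%O -> (w < nth x0 F m)%O.
  move=> im mj ge_w; have mF := ltn_trans mj jF.
  have := wsink (nth x0 F m); rewrite inE notin_take index_uniq // => /(_ im).
  rewrite arc_r // index_uniq // mj andbT negbK.
  case: (comparableP w (nth x0 F m)) => // [mw|wE] _; last first.
    by move: mj; rewrite /j wE index_uniq // ltnn.
  have /(sortedP x0)/(_ m (leq_ltn_trans mj jF))/negP[] := sF.
  exact: lt_le_trans mw ge_w.
elim: k => [|k IH] m im mj; have mltj : m < j by rewrite -mj -addSnnS leq_addr.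
  by apply: gt_pred; rewrite // -addn1 mj nj.
by apply: gt_pred => //; apply/ltW/IH; rewrite ?(leqW im) // addSnnS.
Qed.

Lemma s_r F :
  uniq F -> (forall v, v \in F) -> sorted (fun v w => ~~ (v < w)%O) F ->
  s (r F) = F.
Proof.
move=> uF inF sF.
have sizeF : size F = #|P|.
  by rewrite -(card_uniqP uF); apply: eq_card => v; rewrite inF.
suff take_iter i : i <= size F -> iter i (s_step (r F)) [::] = take i F.
  by rewrite /s -sizeF take_iter // take_size.
elim: i => [|i IH] iF; first by rewrite take0.
have x0 : P by case: F iF {uF inF sF sizeF IH}.
rewrite iterS IH ?(ltnW iF) // /s_step (greatest_sinks_r x0) //.
by rewrite (take_nth x0).
Qed.

(** * From acyclic orientations to paths and back *)

Lemma greatest_sinks A U :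
    acyclic_orientation inc A -> U != set0 ->
  exists v, greatest (sinks A U) = Some v.
Proof.
move=> [[_ orA] acA] U0; apply: greatest_chain; last exact: acyclic_sinks_neq0.
move=> v w /sinksP[vU vsink] /sinksP[wU wsink].
(* An edge between two sinks would be an arc out of one of them. *)
apply: contraT => /orA.
by rewrite (negbTE (vsink w wU)) (negbTE (wsink v vU)).
Qed.

(** Invariant of the iteration of [s_step]. The third clause also forces [w] into [F], since a
    missing [w] has index [size F]. The last clause remembers how the latest term was chosen, so
    that the next one can be compared with it. *)
Definition sink_removal A F : Prop :=
  [/\ uniq F, sorted (fun v w => ~~ (v < w)%O) F,
      (forall v w, v \in F -> arc A v w -> index w F < index v F) &
      (forall F' y, F = rcons F' y ->
         greatest (sinks A [set v | v \notin F']) = Some y)].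

Lemma sink_removal_rcons A F x :
    acyclic_orientation inc A -> sink_removal A F ->
    greatest (sinks A [set v | v \notin F]) = Some x ->
  sink_removal A (rcons F x).
Proof.
move=> [[incA orA] _] [uF sF arcF lastF] /[dup] gx /greatestP[/sinksP[]].
rewrite inE => xF xsink _; split.
- by rewrite rcons_uniq xF.
- case/lastP: F uF sF arcF lastF xF xsink gx => [//|F y] uF sF arcF lastF xF xsink _.
  rewrite -cats1 cat_rcons sorted_cat_cons sF /= andbT.
  have /greatestP[_ yge] := lastF F y erefl; apply/negP => yx.
  suff /yge : x \in sinks A [set v | v \notin F] by move=> /le_gtF; rewrite yx.
  move: xF; rewrite mem_rcons inE negb_or => /andP[_ xF].
  apply/sinksP; rewrite inE; split=> // w; rewrite inE => wF.
  (* Putting [y] back adds only [y] as a possible out-neighbour of [x], and [y] is comparable to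
     [x]. *)
  have [->|wy] := eqVneq w y.
    by apply/negP => /incA; rewrite /Defs.inc gt_comparable.
  by apply: xsink; rewrite inE mem_rcons inE negb_or wy.
- move=> v w; rewrite -cats1 mem_cat !index_cat inE.
  have [vF _ vw|vF /= /eqP->{v vF} xw] := boolP (v \in F).
    have := arcF v w vF vw; case: ifP => // /negbT /memNindex->.
    by rewrite ltnNge index_size.
  have wF : w \in F.
    by apply: contraT => wF; have := xsink w; rewrite inE wF xw => /(_ isT).
  by rewrite wF /= eqxx addn0 index_mem.
- by move=> F' y /rcons_inj[<- <-].
Qed.

Lemma sink_removal_s A :
    acyclic_orientation inc A -> sink_removal A (s A) /\ forall v, v \in s A.
Proof.
move=> aoA.
(* The size shows that no step stalls; [#|P|] distinct terms then exhaust [P]. *)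
suff inv i : i <= #|P| -> sink_removal A (iter i (s_step A) [::]) /\
    size (iter i (s_step A) [::]) = i.
  have [sA sizeA] := inv _ (leqnn #|P|); split=> // v.
  have [uA _ _ _] := sA.
  suff /subset_cardP/(_ (subset_predT _)) -> : #|s A| = #|P| by [].
  by rewrite (card_uniqP uA).
elim: i => [_|i IH iP].
  by split=> //; split=> // -[].
have [sF sizeF] := IH (ltnW iP); rewrite iterS.
set F := iter i _ _ in sF sizeF *.
have U0 : [set v | v \notin F] != set0.
  apply/negP => /eqP U0; move: iP; rewrite ltnNge -sizeF => /negP[].
  apply: leq_trans (card_size F); apply/subset_leq_card/subsetP => v _.
  by have := in_set0 v; rewrite -U0 inE => /negbFE.
have [x gx] := greatest_sinks aoA U0.
by rewrite /s_step gx size_rcons sizeF; split=> //; apply: sink_removal_rcons.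
Qed.

Lemma r_s A : acyclic_orientation inc A -> r (s A) = A.
Proof.
move=> /[dup] aoA [[incA orA] _].
have [[uF _ arcF _] inF] := sink_removal_s aoA.
apply/setP => -[v w]; rewrite -[LHS]/(arc _ v w) -[RHS]/(arc A v w) arc_r //.
apply/andP/idP => [[vw wv]|vw]; last by split; [exact: incA|exact: arcF].
(* [A] directs this edge one way or the other; an arc from [w] to [v] would put [v] before [w] in
   [s A]. *)
have := orA _ _ vw; case: (boolP (arc A w v)); last by rewrite addbF.
by move=> /(arcF _ _ (inF w)); rewrite ltnNge ltnW.
Qed.

End Paths.

From mathcomp Require Import classical_sets functions.

Local Open Scope classical_set_scope.

Theorem theorem3p8 (d : Order.disp_t) (P : finPOrderType d) :
  let paths := [set F : seq P | weakly_decreasing_hampath F] in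
  let orientations :=
    [set A : {set P * P} | acyclic_orientation (@inc d P) A] in
  set_bij paths orientations (@r d P) /\
  [/\ (forall A, orientations A -> paths (s A)),
      (forall F, paths F -> s (r F) = F) &
      (forall A, orientations A -> r (s A) = A)].
Proof.
move=> paths orientations.
have rP F : paths F -> orientations (r F).
  by move=> [/hampath_uniq[uF inF] _]; apply: acyclic_orientation_r.
have sP A : orientations A -> paths (s A).
  move=> /sink_removal_s[[uF sF _ _] inF].
  by split=> //; apply/hampath_uniq.
have rK F : paths F -> s (r F) = F.
  by move=> [/hampath_uniq[uF inF] sF]; apply: s_r.
have sK A : orientations A -> r (s A) = A by exact: r_s.
split=> //; split.
- exact: rP.
- by move=> F G /set_mem/rK FK /set_mem/rK GK rFG; rewrite -FK rFG GK.
- by move=> A oA; exists (s A); [exact: sP|exact: sK].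
Qed.
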